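(* Let $F$ be $\mu$-quasi-strongly monotone with $\mu>0$, let the expected cocoercivity assumption hold, i.e. for all $x\in\mathbb{R}^d$, with $x^*=\mathrm{proj}_{X^*}(x)$, $$\mathbb{E}_{\xi\sim\mathcal{D}}\|F_\xi(x)-F_\xi(x^* )\|^2\le\ell_{\mathcal{D}}\langle F(x)-F(x^* ),x-x^*\rangle,$$ and let $0<\gamma\le\frac{1}{2\ell_{\mathcal{D}}}$. Then for all $k\ge0$ the iterates produced by SGDA-AS satisfy $$\mathbb{E}\|x^k-x^{*,k}\|^2\le(1-\gamma\mu)^k\|x^0-x^{*,0}\|^2+\frac{2\gamma\sigma_*^2}{\mu},$$ where $\sigma_*^2=\max_{x^*\in X^*}\mathbb{E}_{\xi\sim\mathcal{D}}\|F_\xi(x^* )-F(x^* )\|^2$.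
   Context: Norms and inner products on $\mathbb{R}^d$ are Euclidean. $F:\mathbb{R}^d\to\mathbb{R}^d$ is an operator with $F(x)=\mathbb{E}_{\xi\sim\mathcal{D}}[F_\xi(x)]$ for all $x$, where $\mathcal{D}$ is a distribution; $R:\mathbb{R}^d\to\mathbb{R}\cup\{+\infty\}$ is a proper lower semicontinuous convex function. $X^*$ is the (nonempty) set of solutions of the regularized variational inequality: find $x^*\in\mathbb{R}^d$ with $\langle F(x^* ),x-x^*\rangle+R(x)-R(x^* )\ge0$ for all $x\in\mathbb{R}^d$. $\mathrm{proj}_{X^*}(x)=\arg\min_{y\in X^*}\|y-x\|$ (taken to be well defined), and $x^{*,k}=\mathrm{proj}_{X^*}(x^k)$. The quantity $\sigma_*^2$ is finite. $F$ is $\mu$-quasi-strongly monotone if $\langle F(x)-F(x^* ),x-x^*\rangle\ge\mu\|x-x^*\|^2$ for all $x\in\mathbb{R}^d$, where $x^*=\mathrm{proj}_{X^*}(x)$. SGDA-AS: from a deterministic $x^0\in\mathbb{R}^d$, at each iteration sample $\xi^k\sim\mathcal{D}$ independently of previous iterations, set $g^k=F_{\xi^k}(x^k)$ and $x^{k+1}=\mathrm{prox}_{\gamma R}(x^k-\gamma g^k)$, where $\mathrm{prox}_{\gamma R}(x)=\arg\min_{y}\{R(y)+\|y-x\|^2/(2\gamma)\}$. *)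

(* Defs.v *)
From HB Require Import structures.
From mathcomp Require Import all_boot all_order all_algebra finmap.
From mathcomp Require Import all_classical all_reals all_analysis.

Set Implicit Arguments.
Unset Strict Implicit.
Unset Printing Implicit Defensive.

Import Order.TTheory GRing.Theory Num.Theory.
Import numFieldNormedType.Exports.

Local Open Scope classical_set_scope.
Local Open Scope ring_scope.

(* R^d is 'rV[R]_d. The library norm on 'rV[R]_d is the sup norm, hence the
   Euclidean norm below; both induce the same topology. *)
Definition dot (R : realType) (d : nat) (x y : 'rV[R]_d) : R :=
  \sum_(i < d) x ord0 i * y ord0 i.

Definition enorm (R : realType) (d : nat) (x : 'rV[R]_d) : R :=
  Num.sqrt (dot x x).

(* 'rV[R]_d carries no measurable structure in the library. *)
Definition borelRV (R : realType) (d : nat) :=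
  g_sigma_algebraType [set A : set 'rV[R]_d | open A].

Definition argmin (R : realType) (V : Type) (S : set V) (f : V -> \bar R) :
    set V :=
  [set y | S y /\ forall z, S z -> (f y <= f z)%E].

Definition proj_set (R : realType) (d : nat) (S : set 'rV[R]_d) (x : 'rV[R]_d) :
    set 'rV[R]_d :=
  argmin S (fun y => (enorm (y - x))%:E).

Definition proj_on (R : realType) (d : nat) (S : set 'rV[R]_d) (x : 'rV[R]_d) :
    'rV[R]_d :=
  xget x (proj_set S x).

Definition proper_fun (R : realType) (d : nat) (f : 'rV[R]_d -> \bar R) : Prop :=
  (forall x, f x != -oo%E) /\ (exists x, (f x < +oo)%E).

(* In \bar R, 0 * +oo = 0, so the endpoints t = 0 and t = 1 are harmless. *)
Definition econvex (R : realType) (d : nat) (f : 'rV[R]_d -> \bar R) : Prop :=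
  forall (x y : 'rV[R]_d) (t : R), 0 <= t <= 1 ->
    (f (t *: x + (1 - t) *: y)%R <= t%:E * f x + (1 - t)%:E * f y)%E.

Definition prox (R : realType) (d : nat) (gamma : R)
    (reg : 'rV[R]_d -> \bar R) (x : 'rV[R]_d) : 'rV[R]_d :=
  xget x (argmin setT
    (fun y => reg y + (enorm (y - x) ^+ 2 / (2 * gamma))%:E)%E).

(* For proper [reg], a solution x has reg x < +oo: otherwise, since
   a - +oo = -oo in \bar R (even for a = +oo), the inequality fails. *)
Definition vi_sol (R : realType) (d : nat) (F : 'rV[R]_d -> 'rV[R]_d)
    (reg : 'rV[R]_d -> \bar R) : set 'rV[R]_d :=
  [set xs | forall x, (0 <= (dot (F xs) (x - xs))%:E + reg x - reg xs)%E].

Definition quasi_strongly_monotone (R : realType) (d : nat) (mu : R)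
    (F : 'rV[R]_d -> 'rV[R]_d) (X : set 'rV[R]_d) : Prop :=
  forall x, mu * enorm (x - proj_on X x) ^+ 2 <=
    dot (F x - F (proj_on X x)) (x - proj_on X x).

Definition is_expectation (R : realType) (d : nat) (dT : measure_display)
    (T : measurableType dT) (D : probability T R)
    (G : T -> 'rV[R]_d) (m : 'rV[R]_d) : Prop :=
  forall i, D.-integrable setT (fun s => (G s ord0 i)%:E) /\
    'E_D[fun s => G s ord0 i]%E = (m ord0 i)%:E.

Definition expected_cocoercive (R : realType) (d : nat) (dT : measure_display)
    (T : measurableType dT) (D : probability T R) (ell : R)
    (Fs : T -> 'rV[R]_d -> 'rV[R]_d) (F : 'rV[R]_d -> 'rV[R]_d)
    (X : set 'rV[R]_d) : Prop :=
  forall x, ('E_D[fun s => (enorm (Fs s x - Fs s (proj_on X x)) ^+ 2)%R] <=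
    (ell * dot (F x - F (proj_on X x)) (x - proj_on X x))%:E)%E.

(* The maximum over X, as a supremum in \bar R; the two agree whenever the
   maximum is attained. *)
Definition sigma2 (R : realType) (d : nat) (dT : measure_display)
    (T : measurableType dT) (D : probability T R)
    (Fs : T -> 'rV[R]_d -> 'rV[R]_d) (F : 'rV[R]_d -> 'rV[R]_d)
    (X : set 'rV[R]_d) : \bar R :=
  ereal_sup [set 'E_D[fun s => (enorm (Fs s y - F y) ^+ 2)%R]%E | y in X].

Definition mutually_independent (R : realType) (dO dT : measure_display)
    (Omega : measurableType dO) (T : measurableType dT)
    (P : probability Omega R) (I : choiceType) (X : I -> {RV P >-> T}) : Prop :=
  forall (J : {fset I}) (A : I -> set T),
    (forall i, i \in J -> measurable (A i)) ->
    P (\bigcap_(i in [set` J]) (X i @^-1` A i)) =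
      (\prod_(i <- J) P (X i @^-1` A i))%E.

Fixpoint sgda (R : realType) (d : nat) (T : Type) (gamma : R)
    (reg : 'rV[R]_d -> \bar R) (Fs : T -> 'rV[R]_d -> 'rV[R]_d)
    (x0 : 'rV[R]_d) (s : nat -> T) (k : nat) : 'rV[R]_d :=
  if k is j.+1 then
    let x := sgda gamma reg Fs x0 s j in
    prox gamma reg (x - gamma *: Fs (s j) x)
  else x0.

(* Main.v *)
From HB Require Import structures.
Require Import Defs.
From mathcomp Require Import all_boot all_order all_algebra finmap.
From mathcomp Require Import all_classical all_reals all_analysis.
From mathcomp Require Import measurable_realfun ring lra.

Import Order.TTheory GRing.Theory Num.Theory.
Import numFieldNormedType.Exports.
Local Open Scope classical_set_scope.
Local Open Scope ring_scope.

(* A solution q of the variational inequality is a fixed point of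
   u |-> prox (u - gamma F u), so nonexpansiveness of prox bounds the squared
   distance of the next iterate to the solution set by
   |x - q - gamma (F_xi x - F q)|^2, where q = proj x. Taking the expectation over
   xi, with |F_xi x - F q|^2 <= 2 |F_xi x - F_xi q|^2 + 2 |F_xi q - F q|^2, expected
   cocoercivity and gamma ell <= 1/2, gives the factor 1 - gamma mu and the noise
   2 gamma^2 sigma^2, for each fixed x. Since x^k depends on xi^0, ..., xi^(k-1)
   only, the law of (xi^k, x^k) is a product and Tonelli's theorem lifts this bound
   to the iterates. Only the squared distance to the solution set and prox have to
   be measurable, not F nor the projection. *)

Set Implicit Arguments.
Unset Strict Implicit.
Unset Printing Implicit Defensive.

(** * Euclidean inner product and its comparison with the library norm *)

Section euclidean.
Context {R : realType} {d : nat}.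
Implicit Types x y z u v p q : 'rV[R]_d.

Lemma dotC x y : dot x y = dot y x.
Proof. by apply: eq_bigr => i _; rewrite mulrC. Qed.

Lemma dotDl x y z : dot (x + y) z = dot x z + dot y z.
Proof. by rewrite -big_split; apply: eq_bigr => i _; rewrite mxE mulrDl. Qed.

Lemma dotDr x y z : dot x (y + z) = dot x y + dot x z.
Proof. by rewrite dotC dotDl !(dotC _ x). Qed.

Lemma dotZl (a : R) x y : dot (a *: x) y = a * dot x y.
Proof. by rewrite mulr_sumr; apply: eq_bigr => i _; rewrite mxE mulrA. Qed.

Lemma dotZr (a : R) x y : dot x (a *: y) = a * dot x y.
Proof. by rewrite dotC dotZl dotC. Qed.

Lemma dotNl x y : dot (- x) y = - dot x y.
Proof. by rewrite -scaleN1r dotZl mulN1r. Qed.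

Lemma dotNr x y : dot x (- y) = - dot x y.
Proof. by rewrite dotC dotNl dotC. Qed.

Definition dotE := (dotDl, dotDr, dotNl, dotNr, dotZl, dotZr).

Lemma dot_ge0 x : 0 <= dot x x.
Proof. by apply: sumr_ge0 => i _; rewrite -expr2 sqr_ge0. Qed.

Lemma sqr_enorm x : enorm x ^+ 2 = dot x x.
Proof. by rewrite sqr_sqrtr ?dot_ge0. Qed.

Lemma dot_sum_le x y : dot (x + y) (x + y) <= 2 * dot x x + 2 * dot y y.
Proof.
have := dot_ge0 (x - y); rewrite !dotE (dotC y x); lra.
Qed.

Lemma dot_sqrDZ (t : R) x y : dot (x + t *: y) (x + t *: y) =
  dot x x + 2 * t * dot x y + t ^+ 2 * dot y y.
Proof. by rewrite !dotE (dotC y x); ring. Qed.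

Lemma sqr_coord_le_dot x (i : 'I_d) : x ord0 i ^+ 2 <= dot x x.
Proof.
rewrite /dot (bigD1 i)//= -expr2 lerDl.
by apply: sumr_ge0 => j _; rewrite -expr2 sqr_ge0.
Qed.

(** The library norm is the sup norm, attained at one coordinate, whose square is one of the
    summands of [dot x x]. *)
Lemma sqr_norm_le_dot x : `|x| ^+ 2 <= dot x x.
Proof.
have [->|/mx_norm_neq0[[i j] /=]] := eqVneq `|x| 0.
  by rewrite expr0n dot_ge0.
rewrite /Num.norm/= => ->; rewrite (ord1 i) -normrX ger0_norm ?sqr_ge0//.
exact: sqr_coord_le_dot.
Qed.

Lemma continuous_sqr_dist x : continuous (fun y => dot (y - x) (y - x)).
Proof.
have -> : (fun y => dot (y - x) (y - x)) =
    \sum_(i < d) (fun y : 'rV[R]_d => (y ord0 i - x ord0 i) ^+ 2).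
  apply/funext => y; rewrite fct_sumE.
  by apply: eq_bigr => i _; rewrite !mxE -expr2.
elim/big_ind : _ => [|f g cf cg|i _] y.
- exact: cst_continuous.
- exact: (cvgD (cf y) (cg y)).
- have c : {for y, continuous (fun y : 'rV[R]_d => y ord0 i - x ord0 i)}.
    exact: (cvgB (@coord_continuous R 1 d ord0 i y) (cvg_cst _)).
  exact: (cvgM c c).
Qed.

End euclidean.

(** * Lower semicontinuous functions: attained minima and continuous perturbations *)

Section lsc_minimum.
Local Open Scope ereal_scope.

(** Without a minimiser, the open sets [f z < f y], for [z] in [K], cover [K]. In a finite subcover,
    the index with the smallest value of [f] lies in none of the chosen sets. *)
Lemma lsc_compact_argmin {R : realType} {X : ptopologicalType} (f : X -> \bar R)
    (K : set X) : compact K -> K !=set0 -> lower_semicontinuous f ->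
  (forall x, f x != -oo) -> argmin K f !=set0.
Proof.
move=> cK [x0 Kx0] /lower_semicontinuousP lf fN; apply: contrapT => noarg.
have lower y : K y -> exists2 z, K z & f z < f y.
  move=> Ky; apply: contrapT => nz; apply: noarg; exists y; split => // z Kz.
  by rewrite leNgt; apply/negP => zy; apply: nz; exists z.
move: cK; rewrite compact_cover => /(_ _ K (fun z => [set y | f z < f y])).
case=> [z _||D DK cov].
- case fz : (f z) => [a| |]; first exact: lf.
    rewrite [X in open X](_ : _ = set0); first exact: open0.
    by apply/seteqP; split => // y /=; rewrite ltNge leey.
  by move: (fN z); rewrite fz.
- by move=> y /lower[z Kz zy]; exists z.
have [z0 z0D _] := cov _ Kx0.
have [z zD zmin] : exists2 z, z \in D & forall y, y \in D -> f z <= f y.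
  pose s : seq X := D.
  have : s != [::] by apply/eqP => s0; move: z0D; rewrite /= -[_ \in D]/(z0 \in s) s0.
  have -> : (exists2 z, z \in D & forall y, y \in D -> f z <= f y) =
     (exists2 z, z \in s & forall y, y \in s -> f z <= f y) by [].
  elim: s => // a [|b s] IH _.
    by exists a; rewrite ?mem_head// => y; rewrite inE => /eqP ->.
  have [//|z zs zm] := IH.
  have [az|za] := leP (f a) (f z).
    exists a; rewrite ?mem_head// => y; rewrite inE => /orP[/eqP -> //|ys].
    exact: le_trans az (zm _ ys).
  exists z; first by rewrite inE zs orbT.
  by move=> y; rewrite inE => /orP[/eqP ->|/zm//]; exact: ltW.
have [w wD wz] := cov _ (set_mem (DK _ zD)).
by have := le_lt_trans (zmin _ wD) wz; rewrite ltxx.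
Qed.

Lemma lower_semicontinuousD_continuous {R : realType} {X : topologicalType}
    (f : X -> \bar R) (g : X -> R) :
  (forall x, f x != -oo) -> lower_semicontinuous f -> continuous g ->
  lower_semicontinuous (fun x => f x + (g x)%:E).
Proof.
move=> fN lf cg x a afx.
(* The level [b] splits the bound: near [x] both [f > b] and [g > a - b] hold. *)
have [b abg bf] : exists2 b : R, (a - g x < b)%R & b%:E < f x.
  move: afx (fN x); case: (f x) => [r| |]//.
    rewrite -EFinD lte_fin => h _; exists ((r + a - g x) / 2)%R; rewrite ?lte_fin; lra.
  by move=> _ _; exists (a - g x + 1)%R; rewrite ?ltry// ltrDl.
have [V xV Vb] := lf _ _ bf.
exists (V `&` [set y | a - b < g y]%R).
  apply: filterI => //.
  by apply: (cvgr_gt _ (cg x)); lra.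
move=> y [/Vb by_ /= aby].
apply: lt_trans (_ : b%:E + (g y)%:E < _).
  by rewrite -EFinD lte_fin; lra.
by rewrite lteD2rE.
Qed.

End lsc_minimum.

(** * The proximal operator: optimality condition, nonexpansiveness, existence, continuity *)

Section proximal.
Context {R : realType} {d : nat} (gamma : R) (reg : 'rV[R]_d -> \bar R).
Hypothesis gamma_gt0 : 0 < gamma.
Hypothesis reg_proper : proper_fun reg.
Implicit Types u v p q y : 'rV[R]_d.

(** This is the optimality condition of the proximal problem: [gamma^-1 *: (u - p)] is a subgradient
    of [reg] at [p]. *)
Definition prox_vi u p := reg p \is a fin_num /\
  forall y, ((gamma^-1 * dot (u - p) (y - p))%:E + reg p <= reg y)%E.

(** Testing each condition at the other point and adding gives [dot (p - q) (p - q) <= dot (u - v)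
    (p - q)]. The square of [(u - v) - (p - q)] being nonnegative then yields the claim. *)
Lemma prox_vi_nonexpansive u v p q : prox_vi u p -> prox_vi v q ->
  dot (p - q) (p - q) <= dot (u - v) (u - v).
Proof.
move=> [+ hp] [+ hq] => /fineK rp /fineK rq.
have := hp q; have := hq p; rewrite -rp -rq -!EFinD !lee_fin.
move=> h1 h2.
have h : gamma^-1 * (dot (v - q) (p - q) + dot (u - p) (q - p)) <= 0 by lra.
have {}h : dot (v - q) (p - q) + dot (u - p) (q - p) <= 0.
  by rewrite pmulr_rle0 ?invr_gt0 in h.
have := dot_ge0 ((u - v) - (p - q)).
move: h; rewrite !dotE (dotC v u) (dotC q p) (dotC p u) (dotC q u) (dotC p v) (dotC q v).
lra.
Qed.

(** For [u = q - gamma *: F q] the subgradient [gamma^-1 *: (u - q)] is [- F q], so the condition is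
    the variational inequality itself. Finiteness of [reg q] comes from testing at a point where
    [reg] is finite. *)
Lemma vi_sol_prox_vi (F : 'rV[R]_d -> 'rV[R]_d) q :
  vi_sol F reg q -> prox_vi (q - gamma *: F q) q.
Proof.
move=> qX; case: reg_proper => rN [y0 y0lt].
have rq : reg q \is a fin_num.
  rewrite fin_numE rN /=; apply/negP => /eqP q_oo; move: (qX y0) y0lt (rN y0).
    by rewrite q_oo; case: (reg y0).
split=> // y; move: (qX y) (rN y).
rewrite -(fineK rq); case: (reg y) => [r| |]// + _; last by move=> _; exact: leey.
  rewrite -!EFinD !lee_fin => h.
  rewrite [q - _]addrC addrK dotNl dotZl mulrN mulKf ?gt_eqF//; lra.
Qed.

Hypothesis reg_convex : econvex reg.

(** The minimiser [p] is compared with the points [t *: y + (1 - t) *: p] for small [t], where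
    convexity bounds [reg]. *)
Lemma argmin_prox_vi u p :
  argmin setT (fun y => reg y + (enorm (y - u) ^+ 2 / (2 * gamma))%:E)%E p ->
  prox_vi u p.
Proof.
move=> [_ pmin]; case: reg_proper => rN [y0 y0lt].
have rp : reg p \is a fin_num.
  rewrite fin_numE rN /=; apply/negP => /eqP p_oo; have := pmin y0 I.
  rewrite p_oo /= leNgt => /negP; apply; move: y0lt (rN y0).
  by case: (reg y0) => //= r _ _; rewrite -EFinD ltry.
split=> // y; case ry : (reg y) (rN y) => [r| |]// _; last exact: leey.
move: pmin rp; case rpE : (reg p) => [s| |]// pmin _.
rewrite -EFinD lee_fin -subr_ge0 -oppr_le0.
set A := - _.
pose B := dot (y - p) (y - p) / (2 * gamma).
have B0 : 0 <= B by rewrite divr_ge0 ?dot_ge0// mulr_ge0// ltW.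
(* [A] is the amount by which the wanted inequality fails. The comparison at [t], divided by [t],
   leaves only the quadratic remainder [t * B]. *)
have AtB (t : R) : 0 < t -> t <= 1 -> A <= t * B.
  move=> t0 t1; have := @reg_convex y p t; rewrite (ltW t0) t1 => /(_ isT).
  have := pmin (t *: y + (1 - t) *: p) I.
  rewrite !sqr_enorm rpE ry.
  case: (reg (t *: y + _)) (rN (t *: y + (1 - t) *: p)) => [q| |]// _.
  rewrite -!EFinM -!EFinD !lee_fin => h1 h2.
  have e : t *: y + (1 - t) *: p - u = (p - u) + t *: (y - p).
    by apply/rowP => i; rewrite !mxE; ring.
  rewrite e in h1.
  rewrite dot_sqrDZ in h1.
  rewrite -(ler_pM2l t0) /A /B -[u - p]opprB dotNl.
  have -> : gamma^-1 = 2 * (2 * gamma)^-1 by field; rewrite gt_eqF.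
  move: h1 h2; lra.
rewrite leNgt; apply/negP => A0.
have AB : 0 < A + B by rewrite ltr_wpDr.
(* In place of the limit at [t = 0]: this value of [t] turns the bound into [A * A <= 0]. *)
have := AtB (A / (A + B)); rewrite divr_gt0// ler_pdivrMr// mul1r lerDl => /(_ isT B0).
rewrite mulrAC ler_pdivlMr// -subr_le0 mulrDr addrK.
by rewrite leNgt mulr_gt0.
Qed.

Section prox_attained.
Variables (F : 'rV[R]_d -> 'rV[R]_d) (q : 'rV[R]_d).
Hypothesis qX : vi_sol F reg q.
Hypothesis reg_lsc : lower_semicontinuous reg.

(* The solution [q] provides the affine minorant [reg q - <F q, y - q>] of
   [reg], which makes the proximal objective coercive. *)
Lemma prox_argmin_neq0 u :
  argmin setT (fun y => reg y + (enorm (y - u) ^+ 2 / (2 * gamma))%:E)%E !=set0.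
Proof.
set obj := fun y => _.
have [rN [y0 y0lt]] := reg_proper.
have [rq qmin] := vi_sol_prox_vi qX.
have objN y : obj y != -oo%E by rewrite /obj; case: (reg y) (rN y).
(* Completing the square: the affine minorant plus the quadratic term is exactly [C] plus a multiple
   of the squared distance to [c]. *)
pose c := u + gamma *: F q.
have [C objC] : exists C : R, forall y, ((C + dot (y - c) (y - c) / (2 * gamma))%:E <= obj y)%E.
  exists (fine (reg q) - dot (F q) (u - q) - gamma / 2 * dot (F q) (F q)) => y.
  have := qmin y; rewrite -{1}(fineK rq) /obj => h.
  apply: le_trans (leeD2r _ h); rewrite -!EFinD lee_fin sqr_enorm.
  have -> : y - c = (y - u) + (- gamma) *: F q.
    by rewrite scaleNr /c opprD addrA.
  rewrite dot_sqrDZ [q - _]addrC addrK dotNl dotZl [gamma^-1 * _]mulrN mulKf ?gt_eqF//.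
  have -> : y - q = (y - u) + (u - q) by rewrite addrA subrK.
  rewrite (dotDr _ (y - u)) (dotC (y - u) (F q)) le_eqVlt; apply/orP; left; apply/eqP.
  by field; rewrite gt_eqF.
have objlt : (obj y0 < +oo)%E by rewrite /obj lte_add_pinfty ?ltry.
have fy0 : obj y0 \is a fin_num by rewrite fin_numE objN lt_eqF.
(* The summand 1 is there because [r > 1 + t] implies [r ^+ 2 > t] for all reals; with [r] the norm
   of [y - c], points beyond [M] have a larger objective than [y0]. *)
pose M := `|c| + (1 + 2 * gamma * (fine (obj y0) - C)).
pose K := [set y : 'rV[R]_d | `|y| <= M].
have outK y : ~ K y -> (obj y0 < obj y)%E.
  move=> /negP; rewrite -ltNge /M => My.
  apply: lt_le_trans (objC y); rewrite -(fineK fy0) lte_fin -ltrBlDl.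
  rewrite ltr_pdivlMr ?mulr_gt0//; apply: lt_le_trans (sqr_norm_le_dot _).
  have := ler_normD (y - c) c; rewrite subrK => h.
  have h2 : 1 + 2 * gamma * (fine (obj y0) - C) < `|y - c| by lra.
  have := sqr_ge0 (`|y - c| - 1); rewrite mulrC; nra.
have Ky0 : K y0 by apply: contrapT => /outK; rewrite ltxx.
have cK : compact K.
  apply: bounded_closed_compact.
    exists M; split; first exact: num_real.
    by move=> m Mm y /= yM; exact: (le_trans yM (ltW Mm)).
  apply: (@closed_comp _ _ (fun y : 'rV[R]_d => `|y|) [set r | r <= M]).
    by move=> y _; exact: norm_continuous.
  exact: closed_le.
have lobj : lower_semicontinuous obj.
  apply: lower_semicontinuousD_continuous => // y.
  under eq_fun do rewrite sqr_enorm.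
  exact: (cvgM (@continuous_sqr_dist R d u y) (cvg_cst _)).
have [p [Kp pmin]] : argmin K obj !=set0.
  by apply: lsc_compact_argmin => //; exists y0.
exists p; split=> // y _; have [Ky|/outK y0y] := pselect (K y); first exact: pmin.
exact: le_trans (pmin _ Ky0) (ltW y0y).
Qed.

Lemma prox_prox_vi u : prox_vi u (prox gamma reg u).
Proof. by apply: argmin_prox_vi; apply: xgetPex; exact: prox_argmin_neq0. Qed.

Lemma prox_nonexpansive u v :
  dot (prox gamma reg u - prox gamma reg v) (prox gamma reg u - prox gamma reg v)
    <= dot (u - v) (u - v).
Proof. by apply: prox_vi_nonexpansive; exact: prox_prox_vi. Qed.

(** Nonexpansiveness is Euclidean and continuity is in the sup norm, which the Euclidean norm
    dominates. Continuity makes [prox] Borel measurable. *)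
Lemma prox_continuous : continuous (prox gamma reg : 'rV[R]_d -> 'rV[R]_d).
Proof.
move=> u; apply/(@cvgrPdist_lt _ _ _ (nbhs u)) => e e0.
have : \forall v \near u, dot (v - u) (v - u) < e ^+ 2.
  apply: (cvgr_lt _ (@continuous_sqr_dist R d u u)).
  by rewrite /dot big1 ?exprn_gt0// => i _; rewrite subrr mxE mul0r.
apply: filterS => v h; rewrite -ltr_sqr ?nnegrE// ?ltW//.
apply: le_lt_trans h; apply: le_trans (sqr_norm_le_dot _) _.
apply: le_trans (prox_nonexpansive u v) _.
by rewrite -opprB dotNl dotNr opprK.
Qed.

End prox_attained.
End proximal.

(** * Borel measurability of maps into row vectors *)

Section borel_row_vectors.
Context {R : realType} {d : nat}.

Lemma open_measurable_borelRV (U : set 'rV[R]_d) :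
  open U -> measurable (U : set (borelRV R d)).
Proof. exact: sub_sigma_algebra. Qed.

Lemma open_lt_measurable_borelRV (f : 'rV[R]_d -> R) :
  (forall a, open [set x | f x < a]) ->
  measurable_fun [set: borelRV R d] (f : borelRV R d -> R).
Proof.
move=> fo; apply: (measurability _ (RGenInftyO.measurableE R)).
move=> _ [_ [a ->] <-]; rewrite setTI.
apply: open_measurable_borelRV; rewrite [X in open X](_ : _ = [set x | f x < a]) //.
Qed.

Lemma coord_measurable_borelRV (i : 'I_d) :
  measurable_fun [set: borelRV R d] (fun x : borelRV R d => (x : 'rV[R]_d) ord0 i).
Proof.
apply: open_lt_measurable_borelRV => a.
apply: (@open_comp _ _ (fun x : 'rV[R]_d => x ord0 i) [set r | r < a]).
  by move=> x _; exact: coord_continuous.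
exact: open_lt.
Qed.

Lemma continuous_measurable_borelRV (f : 'rV[R]_d -> 'rV[R]_d) :
  continuous f -> measurable_fun setT (f : borelRV R d -> borelRV R d).
Proof.
move=> /continuousP cf.
apply: (@measurability _ _ (borelRV R d) (borelRV R d) _ _ [set A | open A]) => //.
by move=> _ [U oU <-]; rewrite setTI; apply: open_measurable_borelRV; exact: cf.
Qed.

(* An open set is the union of the countably many cubes with rational centre and
   radius [1 / n.+1] that it contains. *)
Lemma measurable_fun_borelRV dZ (Z : measurableType dZ) (f : Z -> borelRV R d) :
  (forall i, measurable_fun setT (fun z => (f z : 'rV[R]_d) ord0 i)) ->
  measurable_fun setT f.
Proof.
move=> mf.
apply: (@measurability _ _ Z (borelRV R d) _ _ [set A | open A]) => //.
move=> _ [U oU <-]; rewrite setTI.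
pose cube (c : 'rV[rat]_d * nat) :=
  [set x : 'rV[R]_d | forall i, `|x ord0 i - ratr (c.1 ord0 i)| < c.2.+1%:R^-1].
have mcube c : measurable (f @^-1` cube c).
  rewrite [X in measurable X](_ : _ = \bigcap_(i in [set: 'I_d])
    ((fun z => (f z : 'rV[R]_d) ord0 i - ratr (c.1 ord0 i)) @^-1`
      [set r | `|r| < c.2.+1%:R^-1])); last first.
    by apply/seteqP; split => [z h i _|z h i]; [exact: h|exact: (h i I)].
  apply: fin_bigcap_measurable => // i _; rewrite -[X in measurable X]setTI.
  apply: (measurable_funB (mf i) (measurable_cst _)) => //.
  apply: open_measurable.
  apply: (@open_comp _ _ (fun r : R => `|r|) [set r | r < c.2.+1%:R^-1]).
    by move=> x _; exact: norm_continuous.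
  exact: open_lt.
rewrite [X in measurable X](_ : _ = \bigcup_c
    (if `[< cube c `<=` U >] then f @^-1` cube c else set0)); last first.
  apply/seteqP; split => [z /= Uz|z [c _]]; last first.
    by case: asboolP => // cU /cU.
  have : nbhs (f z : 'rV[R]_d) U by exact: open_nbhs_nbhs.
  rewrite -nbhs_ballE => -[e /= e0 eU].
  (* Half of [e], since two points of a cube are compared through its centre. *)
  have [n ne] : exists n : nat, n.+1%:R^-1 < e / 2.
    have := near_infty_natSinv_lt (PosNum (divr_gt0 e0 (ltr0Sn R 1))).
    by case=> n _ /(_ n (leqnn _)); exists n.
  have hq i : exists q : rat, `|(f z : 'rV[R]_d) ord0 i - ratr q| < n.+1%:R^-1.
    have : (f z : 'rV[R]_d) ord0 i - n.+1%:R^-1 < (f z : 'rV[R]_d) ord0 i + n.+1%:R^-1.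
      by rewrite ltrBlDr -addrA ltrDl addr_gt0.
    move=> /rat_in_itvoo[q]; rewrite in_itv /= => /andP[q1 q2]; exists q.
    by rewrite distrC ltr_distl q1 q2.
  pose c : 'rV[rat]_d * nat := (\row_i projT1 (cid (hq i)), n).
  have zc : cube c (f z).
    by move=> i; rewrite /c /= mxE; exact: projT2 (cid (hq i)).
  have cU : cube c `<=` U.
    move=> x xc; apply: eU; split => // i j; rewrite (ord1 i).
    rewrite /ball /= (le_lt_trans (ler_distD (ratr (c.1 ord0 j)) _ _))//.
    rewrite (splitr e); apply: ltrD; apply: lt_trans ne; first exact: zc.
    by rewrite distrC; exact: xc.
  by exists c => //; case: asboolP.
apply: countable_bigcupT_measurable => // c.
by case: asboolP => _; [exact: mcube|exact: measurable0].
Qed.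

End borel_row_vectors.

(** * From independence on rectangles to product laws *)

Section independence.
Context {R : realType} {dO dT dS : measure_display} {Omega : measurableType dO}
  {T : measurableType dT} {S : measurableType dS} (P : probability Omega R).
Local Open Scope ereal_scope.

(** Both sides are finite measures in [C]; they agree on rectangles, which are stable under
    intersection and generate the product sigma-algebra. *)
Lemma indep_rectangles (Y : {RV P >-> T}) (X : {RV P >-> S}) (E : set Omega) :
  measurable E ->
  (forall A B, measurable A -> measurable B ->
    P (Y @^-1` A `&` X @^-1` B `&` E) = P (Y @^-1` A `&` X @^-1` B) * P E) ->
  forall C : set (T * S), measurable C ->
    P ((fun w => (Y w, X w)) @^-1` C `&` E) =
    P ((fun w => (Y w, X w)) @^-1` C) * P E.
Proof.
move=> mE rect C mC.
have mYX : measurable_fun setT (fun w => (Y w, X w)).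
  by apply: measurable_fun_pair; exact: measurable_funP.
pose rE := NngNum (fine_ge0 (measure_ge0 P E)).
have rEE : (rE%:num)%:E = P E by rewrite /= fineK ?fin_num_measure.
pose m1 := pushforward (mrestr P mE) (fun w => (Y w, X w)).
pose m2 := mscale rE (pushforward P (fun w => (Y w, X w))).
have : m1 C = m2 mYX C.
  have h1 : forall A, measurable A -> measurable ((fun w => (Y w, X w)) @^-1` A).
    by move=> A mA; rewrite -[X in measurable X]setTI; exact: mYX.
  pose G : set (set (T * S)) :=
    [set C | exists2 A, measurable A & exists2 B, measurable B & A `*` B = C].
  apply: (measure_unique G (fun=> setT)) => //.
  - by rewrite measurable_prod_measurableType.
  - move=> _ _ [A1 mA1 [B1 mB1 <-]] [A2 mA2 [B2 mB2 <-]].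
    exists (A1 `&` A2); first exact: measurableI.
    exists (B1 `&` B2); first exact: measurableI.
    by rewrite setXI.
  - by move=> _; exists setT => //; exists setT => //; rewrite setXTT.
  - by apply/seteqP; split => // x _; exists 0%N.
  - move=> _ [A mA [B mB <-]]; rewrite /= /mscale /= rEE muleC.
    exact: rect.
  - move=> _ /=; rewrite /pushforward /mrestr.
    by apply: le_lt_trans (probability_le1 _ _) _; rewrite ?ltry// preimage_setT setTI.
by rewrite /m1 /m2 /mscale /= rEE muleC.
Qed.

(** The pair [(Y, X)] has the product of [D] and the law of [X] as its law, so Tonelli's theorem
    lets the integral over [D] be taken first. *)
Lemma indep_integral (D : probability T R) (Y : {RV P >-> T}) (X : {RV P >-> S})
    (f : T * S -> \bar R) :
  (forall A, measurable A -> distribution P Y A = D A) ->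
  (forall A B, measurable A -> measurable B ->
    P (Y @^-1` A `&` X @^-1` B) = P (Y @^-1` A) * P (X @^-1` B)) ->
  measurable_fun setT f -> (forall z, 0 <= f z) ->
  \int[P]_w f (Y w, X w) = \int[distribution P X]_y \int[D]_s f (s, y).
Proof.
move=> Ylaw indep mf f0.
have mYX : measurable_fun setT (fun w => (Y w, X w)).
  by apply: measurable_fun_pair; exact: measurable_funP.
transitivity (\int[pushforward P (fun w => (Y w, X w))]_z f z).
  by rewrite ge0_integral_pushforward.
rewrite (@eq_measure_integral _ _ _ _ (D \x distribution P X)); last first.
  move=> C mC _; apply/esym; apply: product_measure_unique => //.
  move=> A B mA mB; transitivity (P (Y @^-1` A) * P (X @^-1` B)).
    exact: indep.
  by congr (_ * _); exact: Ylaw.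
by rewrite fubini_tonelli2.
Qed.

End independence.

(** * Independence of an iterate from the later samples *)

Section iterated_random_map.
Context {R : realType} {dO dT dS : measure_display} {Omega : measurableType dO}
  {T : measurableType dT} {S : measurableType dS} (P : probability Omega R).
Variables (xi : nat -> {RV P >-> T}) (h : T * S -> S) (X : nat -> Omega -> S).
Hypothesis xi_indep : mutually_independent xi.
Hypothesis mh : measurable_fun setT h.
Variable x0 : S.
Hypothesis X0 : forall w, X 0%N w = x0.
Hypothesis XS : forall k w, X k.+1 w = h (xi k w, X k w).
Local Open Scope ereal_scope.

Lemma iterated_measurable k : measurable_fun setT (X k).
Proof.
elim: k => [|k IH]; first by rewrite (_ : X 0%N = cst x0)//; apply/funext.
rewrite (_ : X k.+1 = h \o (fun w => (xi k w, X k w))); last exact/funext.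
by apply: measurableT_comp => //; exact: measurable_fun_pair.
Qed.

Let future (J : {fset nat}) (A : nat -> set T) :=
  \bigcap_(i in [set` J]) (xi i @^-1` A i).

Let measurable_future J A : (forall i, i \in J -> measurable (A i)) ->
  measurable (future J A).
Proof.
move=> mA; apply: fin_bigcap_measurable => // i iJ.
rewrite -[X in measurable X]setTI; apply: measurable_funP => //; exact: mA.
Qed.

(** Induction on [k] for all finite [J] at once: as [X k.+1] is a function of [(xi k, X k)], an
    event about it and the samples in [J] reduces, on rectangles, to one about [X k] and the samples
    in [J] with [k] added. *)
Lemma iterated_indep_future k (J : {fset nat}) (A : nat -> set T) (B : set S) :
  (forall i, i \in J -> (k <= i)%N) -> (forall i, i \in J -> measurable (A i)) ->
  measurable B ->
  P (X k @^-1` B `&` \bigcap_(i in [set` J]) (xi i @^-1` A i)) =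
  P (X k @^-1` B) * P (\bigcap_(i in [set` J]) (xi i @^-1` A i)).
Proof.
elim: k J A B => [|k IH] J A B kJ mA mB.
  have [Bx0|Bx0] := pselect (B x0).
    rewrite (_ : X 0%N @^-1` B = setT) ?setTI ?probability_setT ?mul1e//.
    by apply/seteqP; split => // w _ /=; rewrite X0.
  rewrite (_ : X 0%N @^-1` B = set0) ?set0I ?measure0 ?mul0e//.
  by apply/seteqP; split => // w /=; rewrite X0.
pose Xk : {mfun Omega >-> S} := HB.pack (X k)
  (isMeasurableFun.Build _ _ _ _ _ (iterated_measurable k)).
have mE := measurable_future mA.
have kNJ : k \notin J by apply/negP => /kJ; rewrite ltnn.
have XkS C : X k.+1 @^-1` C = (fun w => (xi k w, Xk w)) @^-1` (h @^-1` C).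
  by apply/seteqP; split => w /=; rewrite XS.
rewrite XkS; apply: indep_rectangles => //; last first.
  by rewrite -[X in measurable X]setTI; exact: mh.
move=> A' B' mA' mB'.
(* Since [k] is not in [J], one family can carry both the new constraint [A'] on [xi k] and the old
   ones on [J]. *)
pose A2 i := if i == k then A' else A i.
have IH2 (J' : {fset nat}) : {subset J' <= k |` J}%fset ->
    P (X k @^-1` B' `&` \bigcap_(i in [set` J']) (xi i @^-1` A2 i)) =
    P (X k @^-1` B') * \prod_(i <- J') P (xi i @^-1` A2 i).
  move=> sJ'.
  have mA2 i : i \in J' -> measurable (A2 i).
    by move=> /sJ'; rewrite /A2 !inE; case: eqP => //= _; exact: mA.
  rewrite (IH J' A2)//; last first.
    by move=> i /sJ'; rewrite !inE => /orP[/eqP ->//|/kJ]; exact: ltnW.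
  by congr (_ * _); exact: xi_indep.
have EJ : \bigcap_(i in [set` J]) (xi i @^-1` A i) =
    \bigcap_(i in [set` J]) (xi i @^-1` A2 i).
  apply: eq_bigcapr => i /= iJ; rewrite /A2.
  by case: eqP => // ik; move: kNJ; rewrite -ik iJ.
have A2k : A2 k = A' by rewrite /A2 eqxx.
have PJ : P (future J A) = \prod_(i <- J) P (xi i @^-1` A2 i).
  rewrite /future EJ; apply: xi_indep => i iJ.
  by rewrite /A2; case: eqP => // _; exact: mA.
(* The factorisation is used twice: for [k] alone, giving the probability of the rectangle, and for
   [k] with [J]. *)
have IHk := IH2 [fset k]%fset; rewrite big_seq_fset1 set_fset1 bigcap_set1 A2k in IHk.
have IHkJ := IH2 (k |` J)%fset (fun _ => id).
rewrite big_fsetU1//= set_fsetU1 bigcap_setU1 A2k -EJ -PJ in IHkJ.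
rewrite [X in X `&` _]setIC -setIA [LHS]IHkJ muleA.
rewrite -IHk; first by rewrite setIC.
by move=> i; rewrite !inE => ->.
Qed.

Lemma iterated_indep k (A : set T) (B : set S) : measurable A -> measurable B ->
  P (xi k @^-1` A `&` X k @^-1` B) = P (xi k @^-1` A) * P (X k @^-1` B).
Proof.
move=> mA mB; have := @iterated_indep_future k [fset k]%fset (fun=> A) B.
rewrite set_fset1 bigcap_set1 setIC muleC; apply => // i; by rewrite inE => /eqP ->.
Qed.

End iterated_random_map.

(** * Calculus of finite means *)

Section mean.
Context {R : realType} {dT : measure_display} {T : measurableType dT}
  (D : probability T R).
Implicit Types f g : T -> R.

(** Integrability is bundled with a real value of the integral, so that linear combinations of means
    are computed in [R] rather than in [\bar R]. *)
Definition has_mean f (m : R) :=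
  D.-integrable setT (EFin \o f) /\ (\int[D]_s (f s)%:E = m%:E)%E.

Lemma has_mean_cst (c : R) : has_mean (fun=> c) c.
Proof.
split; first exact: finite_measure_integrable_cst.
by have := expectation_cst D c; rewrite unlock.
Qed.

Lemma has_meanD f g m n : has_mean f m -> has_mean g n ->
  has_mean (fun s => f s + g s) (m + n).
Proof.
move=> [intf ef] [intg eg]; split.
  exact: (integrableD _ intf intg).
under eq_integral do rewrite EFinD.
by rewrite (integralD _ intf intg)//= ef eg.
Qed.

Lemma has_meanZ (c : R) f m : has_mean f m -> has_mean (fun s => c * f s) (c * m).
Proof.
move=> [intf ef]; split.
  exact: (integrableZl _ c intf).
under eq_integral do rewrite EFinM.
by rewrite (integralZl _ intf)//= ef.
Qed.

Lemma has_mean_sum (I : Type) (r : seq I) (f : I -> T -> R) (m : I -> R) :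
  (forall i, has_mean (f i) (m i)) ->
  has_mean (fun s => \sum_(i <- r) f i s) (\sum_(i <- r) m i).
Proof.
move=> h; elim: r => [|i r IH].
  rewrite big_nil; under eq_fun do rewrite big_nil; exact: has_mean_cst.
rewrite big_cons; under eq_fun do rewrite big_cons; exact: has_meanD.
Qed.

Lemma has_mean_ge0 f m : has_mean f m -> (forall s, 0 <= f s) -> 0 <= m.
Proof.
move=> [_ ef] f0; rewrite -lee_fin -ef.
by apply: integral_ge0 => s _; rewrite lee_fin.
Qed.

(** For a nonnegative function, a finite upper bound on the integral already gives integrability.
    This turns expected cocoercivity and the bound by [sigma2] into statements about real means. *)
Lemma has_mean_expectation_le f (b : R) : measurable_fun setT f ->
  (forall s, 0 <= f s) -> ('E_D[f] <= b%:E)%E -> exists2 m, has_mean f m & m <= b.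
Proof.
move=> mf f0; rewrite unlock => fb.
have i0 : (0 <= \int[D]_s (f s)%:E)%E.
  by apply: integral_ge0 => s _; rewrite lee_fin.
have ifin : (\int[D]_s (f s)%:E)%E \is a fin_num.
  by rewrite ge0_fin_numE// (le_lt_trans fb)// ltry.
exists (fine (\int[D]_s (f s)%:E)%E); last by rewrite -lee_fin fineK.
split; last by rewrite fineK.
apply/integrableP; split; first exact/measurable_EFinP.
under eq_integral do rewrite /= ger0_norm//.
by rewrite (le_lt_trans fb)// ltry.
Qed.

Lemma has_mean_ge_integral f g m : measurable_fun setT f -> (forall s, 0 <= f s) ->
  (forall s, f s <= g s) -> has_mean g m -> (\int[D]_s (f s)%:E <= m%:E)%E.
Proof.
move=> mf f0 fg [/measurable_int mg <-]; apply: ge0_le_integral => //.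
- by move=> s _; rewrite lee_fin.
- exact/measurable_EFinP.
- by move=> s _; rewrite lee_fin.
Qed.

Lemma has_mean_dot d (G : T -> 'rV[R]_d) m v : is_expectation D G m ->
  has_mean (fun s => dot (G s) v) (dot m v).
Proof.
move=> GE; apply: has_mean_sum => i.
have [intG eG] := GE i.
have hG : has_mean (fun s => G s ord0 i) (m ord0 i).
  by split => //; move: eG; rewrite unlock.
rewrite mulrC; under eq_fun do rewrite mulrC; exact: has_meanZ.
Qed.

End mean.

(** * Squared distance to a set with unique projections *)

Section projection.
Context {R : realType} {d : nat} (S : set 'rV[R]_d).
Hypothesis proj_wd : forall x, exists! y, proj_set S x y.
Implicit Types x y z : 'rV[R]_d.

Lemma proj_on_setP x : proj_set S x (proj_on S x).
Proof. by apply: xgetPex; have [y [hy _]] := proj_wd x; exists y. Qed.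

Definition sqr_dist x := dot (x - proj_on S x) (x - proj_on S x).

Lemma sqr_dist_le x z : S z -> sqr_dist x <= dot (x - z) (x - z).
Proof.
move=> Sz; have [_ /(_ z Sz)] := proj_on_setP x.
rewrite lee_fin -(@ler_pXn2r _ 2)// ?nnegrE ?sqrtr_ge0// !sqr_enorm.
by rewrite -!(opprB x) !dotNl !dotNr !opprK.
Qed.

Lemma sqr_dist_ge0 x : 0 <= sqr_dist x.
Proof. exact: dot_ge0. Qed.

(* [sqr_dist] is an infimum of continuous functions, hence upper semicontinuous. *)
Lemma measurable_sqr_dist :
  measurable_fun [set: borelRV R d] (sqr_dist : borelRV R d -> R).
Proof.
apply: open_lt_measurable_borelRV => a.
rewrite (_ : [set x | _] = \bigcup_(z in S) [set x | dot (x - z) (x - z) < a]).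
  apply: bigcup_open => z _.
  apply: (@open_comp _ _ (fun x => dot (x - z) (x - z)) [set r | r < a]).
    by move=> x _; exact: continuous_sqr_dist.
  exact: open_lt.
apply/seteqP; split => x /=; last by move=> [z Sz]; exact: le_lt_trans (sqr_dist_le _ Sz).
by exists (proj_on S x) => //; have [] := proj_on_setP x.
Qed.

End projection.

(** * Expected decrease of the squared distance in one step from a fixed point *)

Section one_step.
Context {R : realType} {d : nat} {dT : measure_display} {T : measurableType dT}
  (D : probability T R) (Fs : T -> 'rV[R]_d -> 'rV[R]_d)
  (F : 'rV[R]_d -> 'rV[R]_d) (reg : 'rV[R]_d -> \bar R).
Local Notation X := (vi_sol F reg).
Hypothesis Fs_meas : measurable_fun setT
  (fun p : T * borelRV R d => (Fs p.1 p.2 : borelRV R d)).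
Hypothesis F_mean : forall x, is_expectation D (fun s => Fs s x) (F x).
Hypothesis reg_proper : proper_fun reg.
Hypothesis reg_lsc : lower_semicontinuous reg.
Hypothesis reg_convex : econvex reg.
Hypothesis proj_wd : forall x, exists! y, proj_set X x y.
Hypothesis sigma_fin : sigma2 D Fs F X \is a fin_num.
Variables (mu ell gamma : R).
Hypothesis mu_gt0 : 0 < mu.
Hypothesis F_qsm : quasi_strongly_monotone mu F X.
Hypothesis F_coco : expected_cocoercive D ell Fs F X.
Hypothesis gamma_gt0 : 0 < gamma.
Hypothesis gamma_le : gamma <= 1 / (2 * ell).

Local Notation sigma := (fine (sigma2 D Fs F X)).
Local Notation pr := (proj_on X).
Implicit Types x y z v : 'rV[R]_d.

Let prX x : X (pr x). Proof. by have [] := proj_on_setP proj_wd x. Qed.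

(** The step-size bound forces this: [1 / (2 * ell)] is positive, whereas the inverse of a negative
    number is negative and that of 0 is 0. *)
Lemma step_ell_gt0 : 0 < ell.
Proof.
have : 0 < 1 / (2 * ell) by exact: lt_le_trans gamma_le.
by rewrite div1r invr_gt0 pmulr_rgt0.
Qed.

Lemma step_gamma_ell : 2 * gamma * ell <= 1.
Proof.
move: gamma_le; rewrite ler_pdivlMr ?mulr_gt0 ?step_ell_gt0//.
by rewrite mulrCA mulrA.
Qed.

Lemma measurable_oracle x i : measurable_fun setT (fun s => Fs s x ord0 i).
Proof.
have mp : measurable_fun setT (fun s : T => (s, x : borelRV R d)).
  exact: measurable_fun_pair.
exact: (measurableT_comp (coord_measurable_borelRV i) (measurableT_comp Fs_meas mp)).
Qed.

Lemma measurable_dot_sqr (G : T -> 'rV[R]_d) :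
  (forall i, measurable_fun setT (fun s => G s ord0 i)) ->
  measurable_fun setT (fun s => dot (G s) (G s)).
Proof.
by move=> mG; apply: measurable_sum => i; apply: measurable_funM.
Qed.

Lemma measurable_oracle_diff x y :
  measurable_fun setT (fun s => dot (Fs s x - Fs s y) (Fs s x - Fs s y)).
Proof.
apply: measurable_dot_sqr => i; under eq_fun do rewrite !mxE.
by apply: measurable_funB; exact: measurable_oracle.
Qed.

Lemma measurable_oracle_noise x :
  measurable_fun setT (fun s => dot (Fs s x - F x) (Fs s x - F x)).
Proof.
apply: measurable_dot_sqr => i; under eq_fun do rewrite !mxE.
by apply: measurable_funB; [exact: measurable_oracle|exact: measurable_cst].
Qed.

(** This quantity links the two assumptions: quasi-strong monotonicity bounds it below, and
    cocoercivity uses it as an upper bound. *)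
Let a x := dot (F x - F (pr x)) (x - pr x).

Lemma oracle_diff_mean x : exists2 m,
  has_mean D (fun s => dot (Fs s x - Fs s (pr x)) (Fs s x - Fs s (pr x))) m
  & m <= ell * a x.
Proof.
apply: has_mean_expectation_le; first exact: measurable_oracle_diff.
  by move=> s; exact: dot_ge0.
by have := F_coco x; under eq_fun do rewrite sqr_enorm.
Qed.

Lemma oracle_noise_mean x : X x -> exists2 m,
  has_mean D (fun s => dot (Fs s x - F x) (Fs s x - F x)) m & m <= sigma.
Proof.
move=> Xx; apply: has_mean_expectation_le; first exact: measurable_oracle_noise.
  by move=> s; exact: dot_ge0.
rewrite fineK//; under eq_fun do rewrite -sqr_enorm.
by apply: ereal_sup_ubound; exists x.
Qed.

(* Positivity of [E|G - ell v|^2], where [G] is the oracle difference and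
   [v = x - pr x], gives [a x <= ell |v|^2]; so [gamma * mu <= 1] unless every
   point is a solution. *)
Lemma contraction_ge0 x : 0 <= (1 - gamma * mu) * sqr_dist X x.
Proof.
set v := x - pr x.
have [m hm mle] := oracle_diff_mean x.
have hGv : has_mean D (fun s => dot (Fs s x) v + - 1 * dot (Fs s (pr x)) v)
    (dot (F x) v + - 1 * dot (F (pr x)) v).
  by apply: has_meanD; [|apply: has_meanZ]; apply: has_mean_dot; exact: F_mean.
have h := has_meanD (has_meanD hm (has_meanZ (- (2 * ell)) hGv))
  (has_mean_cst D (ell ^+ 2 * dot v v)).
have {h} : 0 <= m + - (2 * ell) * a x + ell ^+ 2 * dot v v.
  have -> : a x = dot (F x) v + - 1 * dot (F (pr x)) v.
    by rewrite /a dotDl dotNl mulN1r.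
  apply: (has_mean_ge0 h) => s /=.
  have := dot_ge0 ((Fs s x - Fs s (pr x)) + (- ell) *: v).
  by rewrite dot_sqrDZ (dotDl (Fs s x) (- Fs s (pr x)) v) dotNl; lra.
have := F_qsm x; rewrite sqr_enorm -/v -/(a x) /sqr_dist -/v.
have := dot_ge0 v; have := step_gamma_ell; have ell0 := step_ell_gt0.
set q := dot v v => gl q0 mq h.
(* The bound [m <= ell * a x] cancels half of the cross term. Then [mu * q <= a x <= ell * q], and
   [2 * gamma * ell <= 1] concludes. *)
have : ell * a x <= ell * (ell * q) by lra.
rewrite ler_pM2l// => aq.
have : gamma * (mu * q) <= gamma * (ell * q).
  by rewrite ler_pM2l// (le_trans mq).
nra.
Qed.

Let step (s : T) x := prox gamma reg (x - gamma *: Fs s x).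

Lemma measurable_step : measurable_fun setT
  (fun p : T * borelRV R d => (step p.1 p.2 : borelRV R d)).
Proof.
have mgrad : measurable_fun setT (fun p : T * borelRV R d =>
    (((p.2 : 'rV[R]_d) - gamma *: Fs p.1 p.2) : borelRV R d)).
  apply: measurable_fun_borelRV => i.
  rewrite (_ : (fun _ => _) = fun p : T * borelRV R d =>
    (p.2 : 'rV[R]_d) ord0 i - gamma * (Fs p.1 p.2) ord0 i); last first.
    by apply/funext => p; rewrite !mxE.
  apply: measurable_funB.
    exact: (measurableT_comp (coord_measurable_borelRV i) measurable_snd).
  apply: measurable_funM => //.
  exact: (measurableT_comp (coord_measurable_borelRV i) Fs_meas).
(* The projection of 0 serves as an arbitrary solution. *)
have prox_c := prox_continuous gamma_gt0 reg_proper reg_convex (prX 0) reg_lsc.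
exact: (measurableT_comp (continuous_measurable_borelRV prox_c) mgrad).
Qed.

(** The right-hand side is arranged as a constant in [s] plus multiples of three functions whose
    means are known or bounded. *)
Lemma step_sqr_dist_le s x : sqr_dist X (step s x) <=
  sqr_dist X x + 2 * gamma * dot (F (pr x)) (x - pr x)
  + - (2 * gamma) * dot (Fs s x) (x - pr x)
  + 2 * gamma ^+ 2 * dot (Fs s x - Fs s (pr x)) (Fs s x - Fs s (pr x))
  + 2 * gamma ^+ 2 * dot (Fs s (pr x) - F (pr x)) (Fs s (pr x) - F (pr x)).
Proof.
set q := pr x; set v := x - q.
have qX : X q by exact: prX.
apply: le_trans (sqr_dist_le proj_wd _ qX) _.
have hp := prox_prox_vi gamma_gt0 reg_proper reg_convex qX reg_lsc (x - gamma *: Fs s x).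
have hq := vi_sol_prox_vi gamma_gt0 reg_proper qX.
apply: le_trans (prox_vi_nonexpansive gamma_gt0 hp hq) _.
have -> : x - gamma *: Fs s x - (q - gamma *: F q) =
    v + (- gamma) *: ((Fs s x - Fs s q) + (Fs s q - F q)).
  by apply/rowP => i; rewrite !mxE; ring.
rewrite dot_sqrDZ (dotC v) /sqr_dist -/q -/v.
have -> : dot (Fs s x - Fs s q + (Fs s q - F q)) v = dot (Fs s x) v - dot (F q) v.
  by rewrite addrA subrK dotDl dotNl.
have := dot_sum_le (Fs s x - Fs s q) (Fs s q - F q).
rewrite -(ler_pM2l (exprn_gt0 2 gamma_gt0)); lra.
Qed.

(** The linear terms have mean [- 2 * gamma * a x]. Cocoercivity with [2 * gamma * ell <= 1] returns
    at most [gamma * a x], and the remaining [- gamma * a x] gives the contraction by quasi-strong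
    monotonicity. *)
Lemma step_mean x :
  (\int[D]_s (sqr_dist X (step s x))%:E <=
   ((1 - gamma * mu) * sqr_dist X x + 2 * gamma ^+ 2 * sigma)%:E)%E.
Proof.
have [m2 h2 m2le] := oracle_diff_mean x.
have [m3 h3 m3le] := oracle_noise_mean (prX x).
have h1 := has_mean_dot (x - pr x) (F_mean x).
have h := has_meanD (has_meanD (has_meanD
  (has_mean_cst D (sqr_dist X x + 2 * gamma * dot (F (pr x)) (x - pr x)))
  (has_meanZ (- (2 * gamma)) h1)) (has_meanZ (2 * gamma ^+ 2) h2))
  (has_meanZ (2 * gamma ^+ 2) h3).
apply: le_trans (has_mean_ge_integral _ _ _ h) _ => [|s|s|].
- have mp : measurable_fun setT (fun s : T => (s, x : borelRV R d)).
    exact: measurable_fun_pair.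
  exact: (measurableT_comp (measurable_sqr_dist proj_wd)
    (measurableT_comp measurable_step mp)).
- exact: sqr_dist_ge0.
- exact: step_sqr_dist_le.
rewrite lee_fin.
have := F_qsm x; rewrite sqr_enorm -/(a x) -/(sqr_dist X x) => qsm.
have a0 : 0 <= a x by apply: le_trans qsm; apply: mulr_ge0; [exact: ltW|exact: sqr_dist_ge0].
have e : dot (F x) (x - pr x) = a x + dot (F (pr x)) (x - pr x).
  by rewrite /a dotDl dotNl subrK.
rewrite e.
have g2 : 0 <= 2 * gamma ^+ 2 by rewrite mulr_ge0 ?sqr_ge0.
have k2 := ler_wpM2l g2 m2le.
have k3 := ler_wpM2l g2 m3le.
have k4 : gamma * (mu * sqr_dist X x) <= gamma * a x by rewrite ler_pM2l.
have k5 := ler_wpM2r (mulr_ge0 (ltW gamma_gt0) a0) step_gamma_ell.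
lra.
Qed.

End one_step.

(** * Induction along the iterates *)

Theorem theoremE2 (R : realType) (d : nat)
  (dT dO : measure_display) (T : measurableType dT) (Omega : measurableType dO)
  (D : probability T R) (P : probability Omega R)
  (Fs : T -> 'rV[R]_d -> 'rV[R]_d) (F : 'rV[R]_d -> 'rV[R]_d)
  (reg : 'rV[R]_d -> \bar R)
  (Fs_meas : measurable_fun setT
     (fun p : T * borelRV R d => (Fs p.1 p.2 : borelRV R d)))
  (F_mean : forall x, is_expectation D (fun s => Fs s x) (F x))
  (reg_proper : proper_fun reg)
  (reg_lsc : lower_semicontinuous reg)
  (reg_convex : econvex reg)
  (sol_neq0 : vi_sol F reg !=set0)
  (proj_wd : forall x, exists! y, proj_set (vi_sol F reg) x y)
  (sigma_fin : sigma2 D Fs F (vi_sol F reg) \is a fin_num)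
  (mu : R) (mu_gt0 : 0 < mu)
  (F_qsm : quasi_strongly_monotone mu F (vi_sol F reg))
  (ell : R) (F_coco : expected_cocoercive D ell Fs F (vi_sol F reg))
  (gamma : R) (gamma_gt0 : 0 < gamma) (gamma_le : gamma <= 1 / (2 * ell))
  (xi : nat -> {RV P >-> T})
  (xi_law : forall (k : nat) (A : set T), measurable A ->
     distribution P (xi k) A = D A)
  (xi_indep : mutually_independent xi)
  (x0 : 'rV[R]_d) (k : nat) :
  let x := fun (j : nat) (w : Omega) =>
    sgda gamma reg Fs x0 (fun i => xi i w) j in
  ('E_P[fun w => (enorm (x k w - proj_on (vi_sol F reg) (x k w)) ^+ 2)%R] <=
   ((1 - gamma * mu) ^+ k * enorm (x0 - proj_on (vi_sol F reg) x0) ^+ 2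
    + 2 * gamma * fine (sigma2 D Fs F (vi_sol F reg)) / mu)%:E)%E.

Proof.
cbv zeta; set X := vi_sol F reg; set sigma := fine _.
pose x j w := sgda gamma reg Fs x0 (fun i => xi i w) j.
have prX z : X (proj_on X z) by have [] := proj_on_setP proj_wd z.
have contr := contraction_ge0 Fs_meas F_mean F_qsm F_coco gamma_gt0 gamma_le.
have sigma0 : 0 <= sigma.
  have [m hm] := oracle_noise_mean Fs_meas sigma_fin (prX 0).
  by apply: le_trans; apply: (has_mean_ge0 hm) => s; exact: dot_ge0.
have tail0 : 0 <= 2 * gamma * sigma / mu.
  by rewrite divr_ge0 ?mulr_ge0// ltW.
rewrite unlock; under eq_integral => w _ do rewrite sqr_enorm -/(x k w) -/(sqr_dist X (x k w)).
rewrite sqr_enorm -/(sqr_dist X x0).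
(* A negative factor would break the multiplication in the induction; in that case [contr] makes
   every distance zero and only the nonnegative noise term remains. *)
have [gm1|gm1] := leP 0 (1 - gamma * mu); last first.
  have dist0 z : sqr_dist X z = 0.
    apply/eqP; rewrite eq_le sqr_dist_ge0 andbT.
    by have := contr z; rewrite nmulr_rge0.
  under eq_integral do rewrite dist0.
  by rewrite integral0 dist0 mulr0 add0r lee_fin.
pose h (p : T * borelRV R d) : borelRV R d :=
  prox gamma reg ((p.2 : 'rV[R]_d) - gamma *: Fs p.1 p.2).
have mh : measurable_fun setT h.
  exact: (measurable_step Fs_meas reg_proper reg_lsc reg_convex proj_wd gamma_gt0).
have mdist := measurable_sqr_dist proj_wd.
(* The same iterates, retyped so as to take values in the Borel space. *)
pose xB j : Omega -> borelRV R d := x j.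
have x_0 w : xB 0%N w = x0 by [].
have x_S j w : xB j.+1 w = h (xi j w, xB j w) by [].
elim: k => [|j IH].
  rewrite expr0 mul1r /x /=; have [_ ->] := has_mean_cst P (sqr_dist X x0).
  by rewrite lee_fin lerDl.
have mxB := iterated_measurable mh x_0 x_S.
pose Xj : {RV P >-> borelRV R d} := HB.pack (xB j)
  (isMeasurableFun.Build _ _ _ _ _ (mxB j)).
have mf : measurable_fun setT (fun p => (sqr_dist X (h p))%:E).
  by apply/measurable_EFinP; exact: measurableT_comp mdist mh.
rewrite [leLHS](indep_integral (X := Xj) (f := fun p => (sqr_dist X (h p))%:E)
  (xi_law j)) //; last 2 first.
- exact: (iterated_indep xi_indep mh x_0 x_S).
- by move=> z; rewrite lee_fin sqr_dist_ge0.
have md : measurable_fun setT (fun y : borelRV R d => (sqr_dist X y)%:E).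
  exact/measurable_EFinP.
have d0 y : (0 <= (sqr_dist X y)%:E)%E by rewrite lee_fin sqr_dist_ge0.
have mcd : measurable_fun setT
    (fun y : borelRV R d => ((1 - gamma * mu)%:E * (sqr_dist X y)%:E)%E).
  exact: measurable_funeM.
pose c : R := 2 * gamma ^+ 2 * sigma.
have mc : measurable_fun setT (fun y : borelRV R d => (cst c y)%:E).
  by apply/measurable_EFinP; exact: measurable_cst.
have c0 : 0 <= c by apply: mulr_ge0 => //; apply: mulr_ge0 => //; exact: sqr_ge0.
(* The one-step bound is applied under the integral, for each value [y] of the current iterate. *)
apply: (@le_trans _ _ (\int[distribution P Xj]_y
  ((1 - gamma * mu)%:E * (sqr_dist X y)%:E + (cst c y)%:E))%E).
  apply: ge0_le_integral => //.
  - by move=> y _; apply: integral_ge0 => s _; rewrite lee_fin sqr_dist_ge0.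
  - by apply: (measurable_fun_fubini_tonelli_G (m1 := D) _ mf) => z; exact: d0.
  - exact: (emeasurable_funD mcd mc).
  - move=> y _; rewrite -EFinM -EFinD.
    exact: (step_mean Fs_meas F_mean reg_proper reg_lsc reg_convex proj_wd
      sigma_fin mu_gt0 F_qsm F_coco gamma_gt0 gamma_le).
rewrite ge0_integralD //; last first.
- by move=> y _; rewrite mule_ge0.
rewrite ge0_integralZl_EFin// ge0_integral_distribution//.
have [_ ->] := has_mean_cst (distribution P Xj) c.
(* The noise term [2 * gamma * sigma / mu] is the fixed point of [t |-> (1 - gamma * mu) * t + c],
   so the recursion reproduces it exactly. *)
have -> : ((1 - gamma * mu) ^+ j.+1 * sqr_dist X x0 + 2 * gamma * sigma / mu)%:E =
  ((1 - gamma * mu)%:E *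
    ((1 - gamma * mu) ^+ j * sqr_dist X x0 + 2 * gamma * sigma / mu)%:E + c%:E)%E.
  rewrite -EFinM -EFinD; congr (_%:E); rewrite /c exprS.
  by field; rewrite gt_eqF.
by apply: leeD2r; apply: lee_wpmul2l; [rewrite lee_fin|exact: IH].
Qed.
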